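(* Let $A\in\mathbb{R}^{m\times n}$ and $b\in\mathbb{R}^m$ with $m>n$, suppose that $C=(A\mid b)\in\mathbb{R}^{m\times(n+1)}$ has full column rank, and let $\sigma_1\ge\dots\ge\sigma_{n+1}$ be the singular values of $C$. Suppose that the Total Least Squares problem with data $A$ and $b$ is well posed, i.e. it has exactly one solution, denoted $x_{\mathrm{TLS}}$. Let $\{x_k\}_{k\ge 0}$ be the sequence computed by Algorithm GN-TLS with optimal step length. Then, as $k\to\infty$, $$\|f(x_k)-f(x_{\mathrm{TLS}})\| = O\big((\sigma_{n+1}/\sigma_n)^{2k}\big),\qquad |\eta(x_k)-\sigma_{n+1}| = O\big((\sigma_{n+1}/\sigma_n)^{4k}\big).$$ Furthermore, $\|x_k-x_{\mathrm{TLS}}\| = O\big((\sigma_{n+1}/\sigma_n)^{2k}\big)$.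
   Context: All vector norms are Euclidean; $\|\cdot\|_{\mathrm F}$ is the Frobenius norm; $(E\mid f)$ denotes the matrix obtained by appending the column $f$ to $E$. Total Least Squares (TLS) problem with data $A,b$: minimize $\|(E\mid g)\|_{\mathrm F}$ over $E\in\mathbb{R}^{m\times n}$, $g\in\mathbb{R}^m$ subject to $b+g\in\mathrm{Im}(A+E)$. Given a pair $(\bar E\mid\bar g)$ attaining the minimum, any $x\in\mathbb{R}^n$ with $(A+\bar E)x=b+\bar g$ is called a solution of the TLS problem. For $x\in\mathbb{R}^n$ put $$\mu(x)=\frac{1}{\sqrt{1+x^Tx}},\quad f(x)=\mu(x)(Ax-b)\in\mathbb{R}^m,\quad \eta(x)=\|f(x)\|=\frac{\|Ax-b\|}{\sqrt{1+x^Tx}},$$ $$J(x)=\mu(x)A-\mu(x)^3(Ax-b)x^T$$ ($J(x)$ is the Jacobian matrix of $f$ at $x$). Algorithm GN-TLS with optimal step length (run without stopping criterion): $x_0=\arg\min_x\|Ax-b\|$; for $k=0,1,2,\dots$, $$h_k=\arg\min_{h\in\mathbb{R}^n}\|J(x_k)h+f(x_k)\|,\qquad \alpha_k=\frac{1}{1-\mu(x_k)^2\,x_k^Th_k},\qquad x_{k+1}=x_k+\alpha_kh_k.$$ The constants implied by $O(\cdot)$ may depend on $A$ and $b$ but not on $k$. *)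

(* Defs.v *)
From HB Require Import structures.
From mathcomp Require Import all_boot all_order all_algebra.
From mathcomp Require Import all_classical all_reals all_analysis.

Set Implicit Arguments.
Unset Strict Implicit.
Unset Printing Implicit Defensive.

Import Order.TTheory GRing.Theory Num.Theory.
Import numFieldNormedType.Exports.

Local Open Scope ring_scope.

(* The library norm `|M| on matrices is the max norm, hence the definitions
   of the Euclidean and Frobenius norms. *)

Definition dot (R : realType) (p : nat) (u v : 'cV[R]_p) : R :=
  (u^T *m v) 0 0.

Definition norm2 (R : realType) (p : nat) (v : 'cV[R]_p) : R :=
  Num.sqrt (dot v v).

Definition normF (R : realType) (p q : nat) (M : 'M[R]_(p, q)) : R :=
  Num.sqrt (\sum_(i < p) \sum_(j < q) M i j ^+ 2).

Definition is_argmin (R : realType) (T : Type) (F : T -> R) (t : T) : Prop :=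
  forall t' : T, F t <= F t'.

(* Singular values are indexed from 1, so that sigma j.+1 is the diagonal entry
   in the 0-based column j; only sigma 1, ..., sigma q are constrained. *)

Definition rect_diag_mx (R : realType) (p q : nat) (sigma : nat -> R) :
    'M[R]_(p, q) :=
  \matrix_(i < p, j < q) (if (i == j :> nat) then sigma j.+1 else 0).

Definition orthogonal_mx (R : realType) (p : nat) (U : 'M[R]_p) : Prop :=
  U^T *m U = 1%:M.

(* sigma 1 >= ... >= sigma q >= 0 are the diagonal entries of a singular value
   decomposition C = U * Sigma * V^T; meant for p >= q. *)
Definition singular_values (R : realType) (p q : nat) (C : 'M[R]_(p, q))
    (sigma : nat -> R) : Prop :=
  [/\ forall i : nat, (1 <= i <= q)%N -> 0 <= sigma i,
      forall i j : nat, (1 <= i)%N -> (i <= j)%N -> (j <= q)%N ->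
        sigma j <= sigma i
    & exists (U : 'M[R]_p) (V : 'M[R]_q),
        [/\ orthogonal_mx U, orthogonal_mx V
          & C = U *m rect_diag_mx p q sigma *m V^T]].

Section TLS.
Variables (R : realType) (m n : nat) (A : 'M[R]_(m, n)) (b : 'cV[R]_m).

Definition TLS_feasible (E : 'M[R]_(m, n)) (g : 'cV[R]_m) : Prop :=
  exists x : 'cV[R]_n, (A + E) *m x = b + g.

Definition TLS_minimizer (E : 'M[R]_(m, n)) (g : 'cV[R]_m) : Prop :=
  TLS_feasible E g /\
  forall (E' : 'M[R]_(m, n)) (g' : 'cV[R]_m), TLS_feasible E' g' ->
    normF (row_mx E g) <= normF (row_mx E' g').

Definition TLS_solution (x : 'cV[R]_n) : Prop :=
  exists (E : 'M[R]_(m, n)) (g : 'cV[R]_m),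
    TLS_minimizer E g /\ (A + E) *m x = b + g.

Definition muTLS (x : 'cV[R]_n) : R := (Num.sqrt (1 + dot x x))^-1.

Definition fTLS (x : 'cV[R]_n) : 'cV[R]_m := muTLS x *: (A *m x - b).

Definition etaTLS (x : 'cV[R]_n) : R := norm2 (fTLS x).

Definition jacTLS (x : 'cV[R]_n) : 'M[R]_(m, n) :=
  muTLS x *: A - muTLS x ^+ 3 *: ((A *m x - b) *m x^T).

(* For (A | b) of full column rank the denominator never vanishes along the
   iteration: the vector (x_k ; -1) is a nonzero multiple of
   (C^T C)^-(k+1) e_(n+1), where C = (A | b), and the last entry of the latter
   is positive. *)
Definition optimal_step (x h : 'cV[R]_n) : R :=
  (1 - muTLS x ^+ 2 * dot x h)^-1.

Definition GN_TLS_sequence (x : nat -> 'cV[R]_n) : Prop :=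
  is_argmin (fun y : 'cV[R]_n => norm2 (A *m y - b)) (x 0%N) /\
  forall k : nat, exists h : 'cV[R]_n,
    is_argmin (fun h' : 'cV[R]_n => norm2 (jacTLS (x k) *m h' + fTLS (x k))) h /\
    x k.+1 = x k + optimal_step (x k) h *: h.

End TLS.

(* Main.v *)
Require Import Defs.
From HB Require Import structures.
From mathcomp Require Import all_boot all_order all_algebra.
From mathcomp Require Import all_classical all_reals all_analysis.
From mathcomp Require Import ring lra.

(* Put C = (A | b), M = C^T C and aug x = (x ; -1), so that f(x) is C z / |z| and
   eta(x)^2 is the Rayleigh quotient of M at z = aug x. TLS solutions are the
   minimizers of eta, and a Gauss-Newton step with optimal step length is one step
   of inverse iteration on z, rescaled to keep the last entry -1: the normal
   equations say that M w = c z for a multiple w of the next z. Hence M^(k+1) z_k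
   is a multiple of the last basis vector, as A^T (A x_0 - b) = 0 gives this for
   k = 0. Uniqueness forces the limit to be an eigenvector for sigma_(n+1)^2 with
   nonzero last entry, and in the basis of right singular vectors the coordinate i
   of z_k decays like (sigma_(n+1) / sigma_i)^(2k). *)

Set Implicit Arguments.
Unset Strict Implicit.
Unset Printing Implicit Defensive.

Import Order.TTheory GRing.Theory Num.Theory.
Import numFieldNormedType.Exports.

Local Open Scope classical_set_scope.
Local Open Scope ring_scope.

(** * Euclidean inner product and norm, Frobenius norm, normal equations *)

Section Euclidean.
Variable R : realType.
Implicit Types (p q : nat) (a c : R).

Lemma dotE p (u v : 'cV[R]_p) : dot u v = \sum_i u i 0 * v i 0.
Proof. by rewrite /dot mxE; apply: eq_bigr => i _; rewrite mxE. Qed.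

Lemma dotC p (u v : 'cV[R]_p) : dot u v = dot v u.
Proof. by rewrite !dotE; apply: eq_bigr => i _; rewrite mulrC. Qed.

Lemma dotDl p (u v w : 'cV[R]_p) : dot (u + v) w = dot u w + dot v w.
Proof. by rewrite /dot linearD mulmxDl mxE. Qed.

Lemma dotDr p (u v w : 'cV[R]_p) : dot u (v + w) = dot u v + dot u w.
Proof. by rewrite /dot mulmxDr mxE. Qed.

Lemma dotZl p a (u v : 'cV[R]_p) : dot (a *: u) v = a * dot u v.
Proof. by rewrite /dot linearZ -scalemxAl mxE. Qed.

Lemma dotZr p a (u v : 'cV[R]_p) : dot u (a *: v) = a * dot u v.
Proof. by rewrite /dot -scalemxAr mxE. Qed.

Lemma dotNl p (u v : 'cV[R]_p) : dot (- u) v = - dot u v.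
Proof. by rewrite -scaleN1r dotZl mulN1r. Qed.

Lemma dotNr p (u v : 'cV[R]_p) : dot u (- v) = - dot u v.
Proof. by rewrite -scaleN1r dotZr mulN1r. Qed.

Lemma dot0l p (v : 'cV[R]_p) : dot 0 v = 0.
Proof. by rewrite /dot trmx0 mul0mx mxE. Qed.

Lemma dot_mull p q (B : 'M[R]_(p, q)) u v : dot (B *m u) v = dot u (B^T *m v).
Proof. by rewrite /dot trmx_mul mulmxA. Qed.

Lemma dot_mulr p q (B : 'M[R]_(p, q)) u v : dot u (B *m v) = dot (B^T *m u) v.
Proof. by rewrite dotC dot_mull dotC. Qed.

Lemma dot_col_mx p q (u u' : 'cV[R]_p) (v v' : 'cV[R]_q) :
  dot (col_mx u v) (col_mx u' v') = dot u u' + dot v v'.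
Proof. by rewrite /dot tr_col_mx mul_row_col mxE. Qed.

Lemma dot_deltar p (u : 'cV[R]_p) i : dot u (delta_mx i 0) = u i 0.
Proof. by rewrite /dot -colE !mxE. Qed.

Lemma dot_ge0 p (v : 'cV[R]_p) : 0 <= dot v v.
Proof. by rewrite dotE sumr_ge0 // => i _; rewrite -expr2 sqr_ge0. Qed.

Lemma dot_eq0 p (v : 'cV[R]_p) : (dot v v == 0) = (v == 0).
Proof.
apply/idP/eqP => [|->]; last by rewrite dot0l.
rewrite dotE psumr_eq0 => [/allP v0|i _]; last by rewrite -expr2 sqr_ge0.
apply/colP => i; rewrite mxE.
by have /implyP/(_ isT) := v0 i (mem_index_enum i); rewrite mulf_eq0 orbb => /eqP.
Qed.

Lemma dot_gt0 p (v : 'cV[R]_p) : (0 < dot v v) = (v != 0).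
Proof. by rewrite lt0r dot_ge0 andbT dot_eq0. Qed.

Lemma norm2_ge0 p (v : 'cV[R]_p) : 0 <= norm2 v.
Proof. exact: sqrtr_ge0. Qed.

Lemma sqr_norm2 p (v : 'cV[R]_p) : norm2 v ^+ 2 = dot v v.
Proof. by rewrite sqr_sqrtr ?dot_ge0. Qed.

Lemma norm2Z p a (v : 'cV[R]_p) : norm2 (a *: v) = `|a| * norm2 v.
Proof.
by rewrite /norm2 dotZl dotZr mulrA -expr2 sqrtrM ?sqr_ge0 // sqrtr_sqr.
Qed.

(** The squared norm of [dot v v *: u - dot u v *: v] is [dot v v] times the difference of the two
    sides. *)
Lemma CauchySchwarz_dot p (u v : 'cV[R]_p) :
  dot u v ^+ 2 <= dot u u * dot v v.
Proof.
have [->|v0] := eqVneq v 0.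
  by rewrite dotC !dot0l mulr0 expr0n.
have vv_gt0 : 0 < dot v v by rewrite dot_gt0.
have := dot_ge0 (dot v v *: u - dot u v *: v).
rewrite !(dotDl, dotDr, dotNl, dotNr, dotZl, dotZr) (dotC v u) => h.
rewrite -subr_ge0 -(pmulr_rge0 _ vv_gt0).
by apply: le_trans h _; rewrite le_eqVlt; apply/orP; left; apply/eqP; ring.
Qed.

Lemma ler_norm2D p (u v : 'cV[R]_p) : norm2 (u + v) <= norm2 u + norm2 v.
Proof.
rewrite -(@ler_pXn2r _ 2) ?nnegrE ?addr_ge0 ?norm2_ge0 //.
rewrite sqrrD !sqr_norm2 !(dotDl, dotDr) (dotC v u).
suff : dot u v <= norm2 u * norm2 v by lra.
apply: (le_trans (ler_norm _)).
rewrite -(@ler_pXn2r _ 2) ?nnegrE ?mulr_ge0 ?norm2_ge0 //.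
by rewrite real_normK ?num_real // exprMn !sqr_norm2 CauchySchwarz_dot.
Qed.

Lemma norm2N p (v : 'cV[R]_p) : norm2 (- v) = norm2 v.
Proof. by rewrite -scaleN1r norm2Z normrN1 mul1r. Qed.

Lemma ler_dist_norm2 p (u v : 'cV[R]_p) : `|norm2 u - norm2 v| <= norm2 (u - v).
Proof.
have := ler_norm2D (u - v) v; have := ler_norm2D (v - u) u.
rewrite !subrK -[v - u]opprB norm2N ler_norml => h1 h2.
by apply/andP; split; lra.
Qed.

Lemma normF_ge0 p q (B : 'M[R]_(p, q)) : 0 <= normF B.
Proof. exact: sqrtr_ge0. Qed.

Lemma sqr_normF p q (B : 'M[R]_(p, q)) :
  normF B ^+ 2 = \sum_(i < p) dot (row i B)^T (row i B)^T.
Proof.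
rewrite sqr_sqrtr; last first.
  by apply: sumr_ge0 => i _; apply: sumr_ge0 => j _; rewrite sqr_ge0.
apply: eq_bigr => i _; rewrite dotE; apply: eq_bigr => j _.
by rewrite !mxE expr2.
Qed.

Lemma ler_norm2_mul p q (B : 'M[R]_(p, q)) v :
  norm2 (B *m v) <= normF B * norm2 v.
Proof.
rewrite -(@ler_pXn2r _ 2) ?nnegrE ?mulr_ge0 ?norm2_ge0 ?normF_ge0 //.
rewrite exprMn !sqr_norm2 sqr_normF dotE mulr_suml; apply: ler_sum => i _.
have -> : (B *m v) i 0 = dot (row i B)^T v by rewrite /dot trmxK -row_mul [RHS]mxE.
by rewrite -expr2 CauchySchwarz_dot.
Qed.

Lemma normF_outer p q (u : 'cV[R]_p) (v : 'cV[R]_q) :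
  normF (u *m v^T) = norm2 u * norm2 v.
Proof.
apply/eqP; rewrite -(@eqrXn2 _ 2) ?mulr_ge0 ?norm2_ge0 ?normF_ge0 //; apply/eqP.
rewrite exprMn !sqr_norm2 sqr_normF [dot u u]dotE mulr_suml.
apply: eq_bigr => i _.
suff -> : (row i (u *m v^T))^T = u i 0 *: v by rewrite dotZl dotZr mulrA.
by apply/colP => j; rewrite !mxE big_ord1 !mxE.
Qed.

(* The nonnegative quadratic [|B u + y + t B v|^2 - |B u + y|^2] in [t] has no
   linear term. *)
Lemma normal_equation p q (B : 'M[R]_(p, q)) (y : 'cV[R]_p) u :
  is_argmin (fun v => norm2 (B *m v + y)) u -> B^T *m (B *m u + y) = 0.
Proof.
move=> umin; set F := B *m u + y; set g := B^T *m F.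
apply/eqP; rewrite -dot_eq0; set w := B *m g.
have {umin} Fmin t : norm2 F <= norm2 (F + t *: w).
  by have := umin (u + t *: g); rewrite mulmxDr -scalemxAr addrAC.
have Fw : dot F w = dot g g by rewrite dotC dot_mull.
clearbody w g F.
have key t : 0 <= t * (dot g g *+ 2 + t * dot w w).
  have := Fmin t; rewrite -(@ler_pXn2r _ 2) ?nnegrE ?norm2_ge0 //.
  by rewrite !sqr_norm2 !(dotDl, dotDr, dotZl, dotZr) (dotC w F) Fw; lra.
rewrite eq_le dot_ge0 andbT leNgt; apply/negP => gg_gt0.
have ww_ge0 := dot_ge0 w.
(* At this negative [t] the bracket in [key] is still at least [dot g g > 0], a contradiction; the
   summand 1 covers the case [w = 0]. *)
have := key (- (dot g g / (1 + dot w w))).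
have t0 : 0 < dot g g / (1 + dot w w) by rewrite divr_gt0 //; lra.
rewrite mulNr oppr_ge0 pmulr_rle0 // mulNr -mulrAC -mulrA => h.
have : dot w w / (1 + dot w w) <= 1 by rewrite ler_pdivrMr ?mul1r; lra.
nra.
Qed.

End Euclidean.

(** * Singular values and the Gram matrix *)

Lemma rect_diag_mx_gram (R : realType) p q (s : nat -> R) : (q <= p)%N ->
  (rect_diag_mx p q s)^T *m rect_diag_mx p q s =
  diag_mx (\row_(i < q) s i.+1 ^+ 2).
Proof.
move=> le_qp; apply/matrixP => i j; rewrite !mxE.
rewrite (bigD1 (widen_ord le_qp i)) //= big1 => [|k ne_ki]; last first.
  rewrite !mxE; case: eqP => [eq_ki|_]; last by rewrite mul0r.
  by case/eqP: ne_ki; apply: val_inj.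
rewrite !mxE /= eqxx addr0 val_eqE; case: eqP => [->|_].
  by rewrite mulr1n expr2.
by rewrite mulr0 mulr0n.
Qed.

(** The factor [U] cancels in [C^T C], which leaves a diagonal matrix conjugated by [V]. *)
Lemma svd_gram (R : realType) p q (C : 'M[R]_(p, q)) (s : nat -> R) :
    (q <= p)%N -> singular_values C s ->
  exists2 V : 'M[R]_q, orthogonal_mx V &
    forall (z : 'cV_q) i,
      (V^T *m (C^T *m (C *m z))) i 0 = s i.+1 ^+ 2 * (V^T *m z) i 0.
Proof.
move=> le_qp [_ _ [U [V [UtU VtV ->]]]]; exists V => // z i.
set D := rect_diag_mx p q s; set w := V^T *m z.
suff -> : V^T *m ((U *m D *m V^T)^T *m (U *m D *m V^T *m z)) =
    diag_mx (\row_(i < q) s i.+1 ^+ 2) *m w by rewrite mul_diag_mx !mxE.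
rewrite -(rect_diag_mx_gram s le_qp) -/D !trmx_mul trmxK -!mulmxA -/w.
by rewrite (mulmxA V^T V) VtV mul1mx (mulmxA U^T U) UtU mul1mx.
Qed.

Lemma mulmx_full_inj (R : fieldType) p q (C : 'M[R]_(p, q)) (z : 'cV[R]_q) :
  \rank C = q -> C *m z = 0 -> z = 0.
Proof.
move=> rankC Cz0; apply: trmx_inj; rewrite trmx0; apply/eqP.
have CT_free : row_free C^T by rewrite /row_free mxrank_tr rankC.
by rewrite -(mulmx_free_eq0 _ CT_free) -trmx_mul Cz0 trmx0.
Qed.

(** * Augmented vectors, TLS solutions and Gauss-Newton steps *)

Section Augmented.
Variables (R : realType) (m n : nat) (A : 'M[R]_(m, n)) (b : 'cV[R]_m).
Implicit Types x y h : 'cV[R]_n.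

Local Notation C := (row_mx A b).

Definition aug x : 'cV[R]_(n + 1) := col_mx x (- 1%:M).

(** The last basis vector, in block form to match [aug]; pairing with it reads off the last
    entry. *)
Definition last_delta : 'cV[R]_(n + 1) := col_mx 0 1%:M.

Local Notation e := last_delta.

Lemma mul_aug x : C *m aug x = A *m x - b.
Proof. by rewrite mul_row_col mulmxN mulmx1. Qed.

Lemma dot_last_aug x : dot e (aug x) = -1.
Proof. by rewrite dot_col_mx dot0l add0r /dot tr_scalar_mx mul1mx !mxE. Qed.

Lemma augB x y : aug x - aug y = col_mx (x - y) 0.
Proof. by rewrite /aug opp_col_mx add_col_mx subrr. Qed.

Lemma norm2_augB x y : norm2 (aug x - aug y) = norm2 (x - y).
Proof. by rewrite augB /norm2 dot_col_mx dot0l addr0. Qed.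

(** Any vector with nonzero last entry can be rescaled to meet the condition, so bounds on [etaTLS]
    become bounds on general vectors. *)
Lemma aug_usubmx (z : 'cV[R]_(n + 1)) : dot e z = -1 -> aug (usubmx z) = z.
Proof.
rewrite -{1}[z]vsubmxK dot_col_mx dot0l add0r.
rewrite /dot tr_scalar_mx mul1mx => z_last; rewrite -{2}[z]vsubmxK; congr col_mx.
by rewrite [dsubmx z]mx11_scalar z_last raddfN.
Qed.

Lemma norm2_augE x : norm2 (aug x) = Num.sqrt (1 + dot x x).
Proof.
rewrite /norm2 dot_col_mx addrC; congr (Num.sqrt (_ + _)).
by rewrite dotNl dotNr opprK /dot tr_scalar_mx mul1mx !mxE.
Qed.

Lemma muTLSE x : muTLS x = (norm2 (aug x))^-1.
Proof. by rewrite norm2_augE. Qed.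

Lemma norm2_aug_ge1 x : 1 <= norm2 (aug x).
Proof. by rewrite norm2_augE -{1}sqrtr1 ler_wsqrtr // lerDl dot_ge0. Qed.

Lemma norm2_aug_gt0 x : 0 < norm2 (aug x).
Proof. exact: lt_le_trans ltr01 (norm2_aug_ge1 x). Qed.

Lemma muTLS_gt0 x : 0 < muTLS x.
Proof. by rewrite muTLSE invr_gt0 norm2_aug_gt0. Qed.

Lemma muTLS_sqrK x : muTLS x ^+ 2 * (1 + dot x x) = 1.
Proof.
rewrite /muTLS exprVn sqr_sqrtr ?mulVf ?gt_eqF //.
all: have := dot_ge0 x; lra.
Qed.

Lemma fTLSE x : fTLS A b x = muTLS x *: (C *m aug x).
Proof. by rewrite mul_aug. Qed.

Lemma etaTLSE x : etaTLS A b x = norm2 (C *m aug x) / norm2 (aug x).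
Proof.
rewrite /etaTLS fTLSE norm2Z ger0_norm ?ltW ?muTLS_gt0 //.
by rewrite mulrC muTLSE.
Qed.

Lemma etaTLS_ge0 x : 0 <= etaTLS A b x.
Proof. exact: norm2_ge0. Qed.

Lemma etaTLS_sqrM x :
  etaTLS A b x ^+ 2 * dot (aug x) (aug x) = dot (C *m aug x) (C *m aug x).
Proof.
rewrite etaTLSE expr_div_n !sqr_norm2 divfK // -sqr_norm2.
by rewrite gt_eqF ?exprn_gt0 ?norm2_aug_gt0.
Qed.

(** For fixed [x] the problem becomes that of the smallest matrix with a prescribed value at the
    single vector [aug x]. *)
Lemma residual_aug (E : 'M[R]_(m, n)) (g : 'cV[R]_m) x :
  (A + E) *m x = b + g <-> row_mx E g *m aug x = - (C *m aug x).
Proof.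
rewrite mul_aug mul_row_col mulmxN mulmx1 mulmxDl.
have eq_res : A *m x + E *m x - (b + g) = E *m x - g - - (A *m x - b).
  by move: (A *m x) (E *m x) => u v; apply/colP => i; rewrite !mxE; ring.
split=> H; apply/eqP; rewrite -subr_eq0.
  by rewrite -eq_res H subrr.
by rewrite eq_res H subrr.
Qed.

(* The smallest correction that makes [x] feasible is the rank-one matrix
   [- C z z^T / |z|^2] with [z = aug x]. *)
Lemma TLS_solutionP x : TLS_solution A b x <-> is_argmin (etaTLS A b) x.
Proof.
have lower E g y : (A + E) *m y = b + g ->
    etaTLS A b y <= normF (row_mx E g).
  move/residual_aug => H; rewrite etaTLSE ler_pdivrMr ?norm2_aug_gt0 //.
  by rewrite -[norm2 (C *m _)]norm2N -H ler_norm2_mul.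
have attained y : exists E g, (A + E) *m y = b + g /\
    normF (row_mx E g) = etaTLS A b y.
  set z := aug y; pose G := (- (norm2 z)^-2 *: (C *m z)) *m z^T.
  have z0 := norm2_aug_gt0 y; rewrite -/z in z0.
  exists (lsubmx G), (rsubmx G); rewrite hsubmxK; split.
    apply/residual_aug; rewrite hsubmxK.
    rewrite -mulmxA [z^T *m z]mx11_scalar -/(dot z z) -sqr_norm2.
    by rewrite mul_mx_scalar scalerA mulrN mulfV ?scaleN1r // gt_eqF ?exprn_gt0.
  rewrite normF_outer norm2Z normrN ger0_norm; last first.
    by rewrite invr_ge0 ltW ?exprn_gt0.
  by rewrite etaTLSE -/z; field; rewrite gt_eqF.
split=> [[E [g [[_ Emin] Ex]]] y|xmin].
  have [E' [g' [Ey <-]]] := attained y.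
  by apply: le_trans (lower _ _ _ Ex) (Emin _ _ _); exists y.
have [E [g [Ex nE]]] := attained x; exists E, g; split=> //; split.
  by exists x.
by move=> E' g' [y Ey]; rewrite nE; apply: le_trans (xmin y) (lower _ _ _ Ey).
Qed.

(** The normal equations annihilate the upper block, so only the last entry survives. This starts
    the induction along the iteration. *)
Lemma GN_init x : is_argmin (fun y => norm2 (A *m y - b)) x ->
  exists t, C^T *m (C *m aug x) = t *: e.
Proof.
move=> /normal_equation; rewrite -mul_aug => AtC.
exists (dot b (C *m aug x)).
rewrite tr_row_mx mul_col_mx AtC scale_col_mx scaler0; congr col_mx.
by rewrite [LHS]mx11_scalar scalemx1.
Qed.

(** Here [w] is the next augmented vector times the denominator of the optimal step, left undivided
    since that denominator is not yet known to be nonzero. The normal equations give the upper block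
    of [M w]; the lower one follows from [muTLS_sqrK]. *)
Lemma GN_step x h (w := (1 - muTLS x ^+ 2 * dot x h) *: aug x + col_mx h 0) :
    is_argmin (fun h' => norm2 (jacTLS A b x *m h' + fTLS A b x)) h ->
  exists c, C^T *m (C *m w) = c *: aug x.
Proof.
move=> /normal_equation; set mu := muTLS x; set z := aug x; set J := jacTLS A b x.
have mu0 : mu != 0 by rewrite gt_eqF ?muTLS_gt0.
(* The rank-one part of the Jacobian only changes the coefficient of [C z]. *)
have -> : J *m h + fTLS A b x = mu *: (C *m w).
  rewrite fTLSE /J /jacTLS -mul_aug -/z -/mu mulmxBl -!scalemxAl -(mulmxA (C *m z)).
  rewrite [x^T *m h]mx11_scalar -/(dot x h) mul_mx_scalar.
  rewrite /w mulmxDr -scalemxAr [C *m col_mx h 0]mul_row_col mulmx0 addr0 -/z -/mu.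
  by move: (A *m h) (C *m z) => u v; apply/colP => i; rewrite !mxE; ring.
set r := C *m w; set s := dot (C *m z) r.
have -> : J^T *m (mu *: r) = mu ^+ 2 *: (A^T *m r - (mu ^+ 2 * s) *: x).
  have -> : J^T = mu *: A^T - mu ^+ 3 *: (x *m (C *m z)^T).
    by rewrite /J /jacTLS -mul_aug linearB !linearZ /= trmx_mul trmxK.
  rewrite mulmxBl -!scalemxAl -!scalemxAr -(mulmxA x) [(C *m z)^T *m r]mx11_scalar.
  by rewrite -/(dot (C *m z) r) -/s mul_mx_scalar; move: (A^T *m r) => u;
    apply/colP => i; rewrite !mxE; ring.
move/eqP; rewrite scaler_eq0 expf_eq0 /= (negPf mu0) subr_eq0 => /eqP Atr.
exists (mu ^+ 2 * s); rewrite tr_row_mx mul_col_mx Atr scale_col_mx; congr col_mx.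
have sE : s = dot x (A^T *m r) - dot b r.
  by rewrite /s mul_aug dotDl dotNl dot_mull.
suff br : dot b r = - (mu ^+ 2 * s).
  by rewrite [LHS]mx11_scalar -/(dot b r) br scalerN scalemx1 raddfN.
have := muTLS_sqrK x; rewrite -/mu; move: sE; rewrite Atr dotZr => sE muK.
have -> : dot b r = mu ^+ 2 * s * dot x x - s by lra.
have -> : mu ^+ 2 * s * dot x x = (mu ^+ 2 * (1 + dot x x)) * s - mu ^+ 2 * s.
  by ring.
by rewrite muK; ring.
Qed.

End Augmented.

(** * Coordinates in the basis of right singular vectors *)

Section SpectralCoordinates.
Variables (R : realType) (p q : nat) (C : 'M[R]_(p, q)) (V : 'M[R]_q).
Variable s : nat -> R.
Hypothesis V_orth : orthogonal_mx V.
Hypothesis gram_coord : forall (z : 'cV_q) i,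
  (V^T *m (C^T *m (C *m z))) i 0 = s i.+1 ^+ 2 * (V^T *m z) i 0.
Hypothesis rank_C : \rank C = q.

Lemma dot_coord (u v : 'cV_q) : dot (V^T *m u) (V^T *m v) = dot u v.
Proof. by rewrite dot_mull trmxK mulmxA (mulmx1C V_orth) mul1mx. Qed.

Lemma norm2_coord (u : 'cV_q) : norm2 (V^T *m u) = norm2 u.
Proof. by rewrite /norm2 dot_coord. Qed.

Lemma dot_gram (u v : 'cV_q) :
  dot (C *m u) (C *m v) =
  \sum_(i < q) s i.+1 ^+ 2 * ((V^T *m u) i 0 * (V^T *m v) i 0).
Proof.
rewrite dot_mull -dot_coord dotE; apply: eq_bigr => i _.
by rewrite gram_coord mulrCA.
Qed.

Lemma dot_col (u : 'cV_q) j : dot u (col j V) = (V^T *m u) j 0.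
Proof. by rewrite colE dot_mulr dot_deltar. Qed.

Lemma dot_gram_col (u : 'cV_q) j :
  dot (C *m u) (C *m col j V) = s j.+1 ^+ 2 * dot u (col j V).
Proof. by rewrite dot_mulr dot_col gram_coord dot_col. Qed.

Lemma dot_col_self j : dot (col j V) (col j V) = 1.
Proof. by rewrite dot_col colE mulmxA V_orth mul1mx mxE !eqxx. Qed.

(** A zero singular value would put a unit column of [V] in the kernel of [C]. *)
Lemma sigma_neq0 (i : 'I_q) : s i.+1 != 0.
Proof.
apply/eqP => si0; have := dot_gram_col (col i V) i.
rewrite si0 expr0n mul0r => /eqP; rewrite dot_eq0 => /eqP.
move/(mulmx_full_inj rank_C) => v0; have := dot_col_self i.
by rewrite v0 dot0l => /eqP; rewrite eq_sym oner_eq0.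
Qed.

Lemma rayleigh_ge (a : R) (z : 'cV_q) : 0 <= a ->
    (forall i : 'I_q, a <= s i.+1) ->
  a ^+ 2 * dot z z <= dot (C *m z) (C *m z).
Proof.
move=> a0 le_as; rewrite dot_gram -(dot_coord z) dotE mulr_sumr.
apply: ler_sum => i _; rewrite ler_wpM2r -?expr2 ?sqr_ge0 //.
by rewrite lerXn2r ?nnegrE ?(le_trans a0).
Qed.

End SpectralCoordinates.

(** * Rate of inverse iteration and norm estimates *)

Lemma ler_norm2 (R : realType) p (u v : 'cV[R]_p) :
  (forall i, `|u i 0| <= v i 0) -> norm2 u <= norm2 v.
Proof.
move=> le_uv; rewrite ler_wsqrtr // !dotE; apply: ler_sum => i _.
rewrite -!expr2 -[_ ^+ 2]real_normK ?num_real //.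
by rewrite lerXn2r ?nnegrE ?(le_trans _ (le_uv i)).
Qed.

(* Writing [y k i = tau * g i * r i] with [r i = (s N / s i) ^ 2(k+1)], so that
   [r N = 1], the normalization gives [-1 = tau * \sum_i g i ^ 2 * r i], and [tau]
   stays bounded by [1 / g N ^ 2]. *)
Lemma inverse_iteration_bound (R : realType) p (N : 'I_p) (g ystar : 'cV[R]_p)
    (y : nat -> 'cV[R]_p) (s : 'I_p -> R) (a : R) :
    0 < s N -> (forall i, s N <= s i) -> 0 < a ->
    (forall i, i != N -> a <= s i) -> s N <= a ->
    g N 0 != 0 ->
    dot g ystar = -1 -> (forall i, i != N -> ystar i 0 = 0) ->
    (forall k, dot g (y k) = -1) ->
    (forall k, exists t, forall i, s i ^+ (2 * k.+1) * y k i 0 = t * g i 0) ->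
  exists2 K, 0 <= K &
    forall k, norm2 (y k - ystar) <= K * (s N / a) ^+ (2 * k).
Proof.
move=> sN0 sN_min a0 le_as le_sNa gN0 gystar ystar0 gy yP.
pose c i := `|g i 0| / g N 0 ^+ 2.
(* Coordinate [N] does not decay; its error is recovered from the others, as both [y k] and [ystar]
   have product -1 with [g]. *)
pose cN := (\sum_(i | i != N) `|g i 0| * c i) / `|g N 0|.
pose bnd : 'cV[R]_p := \col_i (if i == N then cN else c i).
have c0 i : 0 <= c i by rewrite divr_ge0 ?sqr_ge0.
exists (norm2 bnd); first exact: norm2_ge0.
move=> k; set rho := s N / a; set eps := rho ^+ (2 * k).
have rho0 : 0 <= rho by rewrite divr_ge0 // ltW.
have eps0 : 0 <= eps by rewrite exprn_ge0.
have s0 i : 0 < s i by apply: lt_le_trans (sN_min i).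
have y_small i : i != N -> `|y k i 0| <= c i * eps.
  move=> iN; have [t tP] := yP k.
  pose tau := t / s N ^+ (2 * k.+1); pose r j := (s N / s j) ^+ (2 * k.+1).
  have r0 j : 0 <= r j by rewrite exprn_ge0 // divr_ge0 // ltW.
  have yE j : y k j 0 = tau * g j 0 * r j.
    have sn0 l : s l ^+ (2 * k.+1) != 0 by rewrite expf_neq0 // gt_eqF.
    transitivity (t * g j 0 / s j ^+ (2 * k.+1)); first by rewrite -tP mulrC mulKf.
    by rewrite /tau /r expr_div_n; field; rewrite !sn0.
  have tau_bnd : `|tau| * g N 0 ^+ 2 <= 1.
    have := gy k; rewrite dotE (bigD1 N) //=.
    under [X in _ + X]eq_bigr => j _.
      rewrite yE (_ : _ * _ = tau * (g j 0 ^+ 2 * r j)); last by ring.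
      over.
    rewrite -mulr_sumr yE /r divff ?gt_eqF // expr1n mulr1 => tauS.
    set S := \sum_(j | _) _ in tauS.
    have S0 : 0 <= S by apply: sumr_ge0 => j _; rewrite mulr_ge0 ?sqr_ge0 ?r0.
    have {tauS} : tau * (g N 0 ^+ 2 + S) = -1 by rewrite -tauS; ring.
    move/(congr1 Num.norm); rewrite normrM normrN1 => <-.
    rewrite ler_wpM2l // ger0_norm ?lerDl //.
    by rewrite addr_ge0 ?sqr_ge0.
  (* The exponent drops from [2 * k.+1] to [2 * k], which is harmless because [rho <= 1]. *)
  have r_le : r i <= eps.
    apply: (@le_trans _ _ (rho ^+ (2 * k.+1))).
      rewrite lerXn2r ?nnegrE ?divr_ge0 ?(ltW (s0 _)) ?(ltW a0) //.
      by rewrite ler_pM2l // lef_pV2 ?posrE // le_as.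
    rewrite ler_wiXn2l // ?ler_pdivrMr ?mul1r // leq_mul2l leqnSn orbT //.
  clearbody tau; rewrite yE !normrM (ger0_norm (r0 i)) ler_pM ?mulr_ge0 //.
  rewrite /c mulrC ler_wpM2l // -[leRHS]mul1r ler_pdivlMr //.
  by rewrite lt0r sqr_ge0 sqrf_eq0 gN0.
have -> : norm2 bnd * eps = norm2 (eps *: bnd) by rewrite norm2Z ger0_norm // mulrC.
apply: ler_norm2 => i; rewrite !mxE; case: eqP => [->|/eqP iN]; last first.
  by rewrite ystar0 // subr0 mulrC y_small.
rewrite mulrCA mulrA ler_pdivlMr ?normr_gt0 // -normrM mulrBl.
have -> : ystar N 0 * g N 0 = -1.
  rewrite -gystar dotE (bigD1 N) //= big1 ?addr0 1?mulrC // => j jN.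
  by rewrite ystar0 ?mulr0.
have -> : y k N 0 * g N 0 - -1 = - \sum_(i | i != N) g i 0 * y k i 0.
  by rewrite -(gy k) dotE (bigD1 N) //=; ring.
rewrite normrN mulr_suml (le_trans (ler_norm_sum _ _ _)) //.
by apply: ler_sum => j jN; rewrite normrM -mulrA ler_wpM2l ?y_small.
Qed.

(** The witness is [K + 1] because [K] may vanish while the constant must be positive. *)
Lemma eqO_of_bound (R : realType) (f g : nat -> R) K :
  0 <= K -> (forall k, `|f k| <= K * `|g k|) -> f =O_\oo g.
Proof.
move=> K0 fg; apply/eqO_exP; exists (K + 1); first by rewrite ltr_wpDl.
by apply: nearW => k; apply: le_trans (fg k) _; rewrite ler_wpM2r // lerDl.
Qed.

(** The difference splits into [u - v] over the norm of [u] and a multiple of [v] measuring the gap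
    between the norms; each part has norm at most that of [u - v]. *)
Lemma norm2_normalizeB (R : realType) p (u v : 'cV[R]_p) :
    1 <= norm2 u -> 1 <= norm2 v ->
  norm2 ((norm2 u)^-1 *: u - (norm2 v)^-1 *: v) <= 2 * norm2 (u - v).
Proof.
move=> u1 v1.
have u0 : 0 < norm2 u by apply: lt_le_trans u1.
have v0 : 0 < norm2 v by apply: lt_le_trans v1.
have -> : (norm2 u)^-1 *: u - (norm2 v)^-1 *: v =
    (norm2 u)^-1 *: (u - v) + ((norm2 u)^-1 - (norm2 v)^-1) *: v.
  by rewrite scalerBr scalerBl addrA subrK.
apply: le_trans (ler_norm2D _ _) _; rewrite !norm2Z mulr_natl mulr2n lerD //.
  by rewrite ger0_norm ?invr_ge0 ?norm2_ge0 // ler_piMl ?norm2_ge0 ?invf_le1.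
have -> : (norm2 u)^-1 - (norm2 v)^-1 =
    (norm2 u)^-1 * (norm2 v - norm2 u) * (norm2 v)^-1.
  by field; rewrite !gt_eqF.
rewrite !normrM !normfV !(ger0_norm (norm2_ge0 _)) mulfVK ?gt_eqF //.
rewrite distrC; apply: le_trans (ler_dist_norm2 _ _).
by rewrite ler_piMl // invf_le1.
Qed.

(** * Consequences of uniqueness, and the invariant of the iteration *)

Section GaussNewton.
Variables (R : realType) (m n : nat) (A : 'M[R]_(m, n)) (b : 'cV[R]_m).
Variables (sigma : nat -> R) (V : 'M[R]_(n + 1)) (N : 'I_(n + 1)).
Implicit Types x y h : 'cV[R]_n.

Local Notation C := (row_mx A b).
Local Notation e := (last_delta R n).
Local Notation v := (col N V).
Local Notation gam := (V^T *m e).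
Local Notation s := (sigma N.+1).

Hypothesis V_orth : orthogonal_mx V.
Hypothesis gram_coord : forall (z : 'cV_(n + 1)) i,
  (V^T *m (C^T *m (C *m z))) i 0 = sigma i.+1 ^+ 2 * (V^T *m z) i 0.
Hypothesis sigma_gt0 : forall i : 'I_(n + 1), 0 < sigma i.+1.
Hypothesis sigma_min : forall i : 'I_(n + 1), s <= sigma i.+1.

Lemma etaTLS_ge_sigma x : s <= etaTLS A b x.
Proof.
rewrite etaTLSE ler_pdivlMr ?norm2_aug_gt0 //.
rewrite -(@ler_pXn2r _ 2) ?nnegrE ?mulr_ge0 ?norm2_ge0 ?(ltW (sigma_gt0 N)) //.
rewrite exprMn !sqr_norm2.
exact: (rayleigh_ge V_orth gram_coord _ (ltW (sigma_gt0 N)) sigma_min).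
Qed.

Lemma etaTLS_sigma_argmin x :
    dot (C *m aug x) (C *m aug x) = s ^+ 2 * dot (aug x) (aug x) ->
  is_argmin (etaTLS A b) x.
Proof.
move=> Cx y; apply: le_trans (etaTLS_ge_sigma y).
rewrite etaTLSE ler_pdivrMr ?norm2_aug_gt0 //.
rewrite -(@ler_pXn2r _ 2) ?nnegrE ?mulr_ge0 ?norm2_ge0 ?(ltW (sigma_gt0 N)) //.
by rewrite exprMn !sqr_norm2 Cx.
Qed.

(* A vector [z] with last entry 0 is the mean of [z + aug x] and [z - aug x],
   which are multiples of augmented vectors. *)
Lemma rayleigh_argmin x : is_argmin (etaTLS A b) x ->
  forall z, etaTLS A b x ^+ 2 * dot z z <= dot (C *m z) (C *m z).
Proof.
move=> xmin; set l := etaTLS A b x ^+ 2.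
have bnd z : dot e z != 0 -> l * dot z z <= dot (C *m z) (C *m z).
  move=> z0; pose a := - (dot e z)^-1.
  have a0 : a != 0 by rewrite oppr_eq0 invr_eq0.
  have /aug_usubmx : dot e (a *: z) = -1 by rewrite dotZr mulNr mulVf.
  set y := usubmx _ => yE.
  have := xmin y; rewrite -(@ler_pXn2r _ 2) ?nnegrE ?etaTLS_ge0 // -/l.
  have yy0 : 0 < dot (aug y) (aug y) by rewrite -sqr_norm2 exprn_gt0 ?norm2_aug_gt0.
  rewrite -(ler_pM2r yy0) etaTLS_sqrM yE -scalemxAr !(dotZl, dotZr) => le_a.
  have a2 : 0 < a * a by rewrite -expr2 lt0r sqr_ge0 sqrf_eq0 a0.
  by rewrite -(ler_pM2l a2); lra.
move=> z; have [z0|] := eqVneq (dot e z) 0; last exact: bnd.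
(* In the sum of the two bounds the cross terms cancel, and the terms in [aug x] cancel by
   [etaTLS_sqrM]. *)
have h1 := bnd (z + aug x); have h2 := bnd (z - aug x).
rewrite !(mulmxDr, mulmxN, dotDl, dotDr, dotNl, dotNr) z0 dot_last_aug in h1 h2.
have {}h1 := h1 ltac:(by rewrite add0r oppr_eq0 oner_eq0).
have {}h2 := h2 ltac:(by rewrite add0r opprK oner_eq0).
rewrite -etaTLS_sqrM -/l in h1 h2; lra.
Qed.

(** The bound of [rayleigh_argmin] is tested at [v], whose last entry is not yet known to be
    nonzero. *)
Lemma etaTLS_argmin x : is_argmin (etaTLS A b) x -> etaTLS A b x = s.
Proof.
move=> xmin; apply/eqP; rewrite eq_le etaTLS_ge_sigma andbT.
rewrite -(@ler_pXn2r _ 2) ?nnegrE ?etaTLS_ge0 ?(ltW (sigma_gt0 N)) //.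
have := rayleigh_argmin xmin v.
by rewrite (dot_gram_col gram_coord) (dot_col_self V_orth) !mulr1.
Qed.

(** If [v] had last entry 0, then [aug x + v] would give a second minimizer. Otherwise the multiple
    of [v] with last entry -1 is itself a minimizer. *)
Lemma unique_argmin x : is_argmin (etaTLS A b) x ->
    (forall y, is_argmin (etaTLS A b) y -> y = x) ->
  gam N 0 != 0 /\ aug x = - (gam N 0)^-1 *: v.
Proof.
move=> xmin xuniq; have gamE : gam N 0 = dot e v by rewrite dot_col.
have uniq_of z : dot e z = -1 ->
    dot (C *m z) (C *m z) = s ^+ 2 * dot z z -> z = aug x.
  by move=> /aug_usubmx <- /etaTLS_sigma_argmin /xuniq ->.
have Cv : dot (C *m v) (C *m v) = s ^+ 2.
  by rewrite (dot_gram_col gram_coord) (dot_col_self V_orth) mulr1.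
have vv := dot_col_self V_orth N.
have gam0 : gam N 0 != 0.
  rewrite gamE; apply/eqP => ev0.
  have : aug x + v = aug x.
    apply: uniq_of; first by rewrite dotDr ev0 addr0 dot_last_aug.
    rewrite mulmxDr !(dotDl, dotDr) Cv vv -etaTLS_sqrM (etaTLS_argmin xmin).
    rewrite [dot (C *m v) _]dotC (dotC v).
    by rewrite (dot_gram_col gram_coord); ring.
  move/(canRL (addKr _)); rewrite addNr => v0.
  by move: vv; rewrite v0 dot0l => /eqP; rewrite eq_sym oner_eq0.
split=> //; apply/esym/uniq_of.
  by rewrite dotZr -gamE mulNr mulVf.
by rewrite -scalemxAr !(dotZl, dotZr) Cv vv; ring.
Qed.

(** This is [M^(k+1) z_k = t e] in singular coordinates, where powers of [M] become even powers of
    the singular values. *)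
Lemma GN_invariant (x : nat -> 'cV[R]_n) : gam N 0 != 0 ->
    GN_TLS_sequence A b x ->
  forall k, exists t, forall i : 'I_(n + 1),
    sigma i.+1 ^+ (2 * k.+1) * (V^T *m aug (x k)) i 0 = t * gam i 0.
Proof.
move=> gam0 [x0 xS]; elim=> [|k [t IH]].
  have [t Mz] := GN_init x0; exists t => i.
  by rewrite muln1 -gram_coord Mz -scalemxAr mxE.
have [h [hmin ->]] := xS k; have [c] := GN_step hmin.
set beta := 1 - _; set w := _ + _ => Mw.
have ew : dot e w = - beta.
  by rewrite dotDr dotZr dot_last_aug dot_col_mx dot0l dotC dot0l; ring.
have wE (i : 'I_(n + 1)) :
      sigma i.+1 ^+ (2 * k.+2) * (V^T *m w) i 0 = c * t * gam i 0.
  rewrite (_ : 2 * k.+2 = 2 * k.+1 + 2)%N; last by rewrite mulnS addnC.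
  rewrite exprD -mulrA -gram_coord Mw -scalemxAr mxE mulrCA IH.
  by rewrite mulrA.
have sX (i : 'I_(n + 1)) : 0 < sigma i.+1 ^+ (2 * k.+2) by rewrite exprn_gt0.
(* By the choice of the optimal step, [w - aug (x k)] is orthogonal to [aug (x k)]. *)
have w_neq0 : w != 0.
  apply/eqP => w0; have : dot (aug (x k)) w = norm2 (aug (x k)) ^+ 2.
    have xh : dot (aug (x k)) (col_mx h 0) = dot (x k) h.
      by rewrite dot_col_mx (dotC (- 1%:M)) dot0l addr0.
    rewrite /w dotDr dotZr xh sqr_norm2.
    rewrite /beta muTLSE exprVn -sqr_norm2; field.
    by rewrite gt_eqF ?norm2_aug_gt0.
  rewrite w0 dotC dot0l => /esym/eqP; apply/negP.
  by rewrite gt_eqF ?exprn_gt0 ?norm2_aug_gt0.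
(* If [beta] vanished, [w] would be orthogonal to [e]. But [w] is [c * t] times [M^-(k+2) e], whose
   product with [e] is positive since [gam N 0 != 0]; so [c * t = 0] and [w = 0]. *)
have beta0 : beta != 0.
  apply/eqP => b0; move: ew; rewrite b0 oppr0 => ew.
  have [ct0|ct0] := eqVneq (c * t) 0.
    case/eqP: w_neq0; apply/eqP; rewrite -dot_eq0 -(dot_coord V_orth) dot_eq0.
    apply/eqP/colP => i; rewrite [RHS]mxE; apply/eqP.
    by have /eqP := wE i; rewrite ct0 mul0r mulf_eq0 gt_eqF.
  have : c * t * (\sum_(i < n + 1) gam i 0 ^+ 2 / sigma i.+1 ^+ (2 * k.+2)) = 0.
    rewrite -[RHS]ew -(dot_coord V_orth) dotE mulr_sumr; apply: eq_bigr => i _.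
    have -> : (V^T *m w) i 0 = c * t * gam i 0 / sigma i.+1 ^+ (2 * k.+2).
      by rewrite -wE mulrC mulKf // gt_eqF.
    by ring.
  move/eqP; rewrite mulf_eq0 (negPf ct0) /=.
  rewrite psumr_eq0 => [/allP/(_ N (mem_index_enum N))|i _]; last first.
    by rewrite divr_ge0 ?sqr_ge0 ?ltW.
  by rewrite /= mulf_eq0 sqrf_eq0 (negPf gam0) invr_eq0 gt_eqF.
exists (beta^-1 * (c * t)) => i.
have -> : aug (x k + optimal_step (x k) h *: h) = beta^-1 *: w.
  rewrite /optimal_step -/beta /w scalerDr scalerA mulVf // scale1r.
  by rewrite scale_col_mx scaler0 /aug add_col_mx addr0.
by rewrite -scalemxAr mxE mulrCA wE mulrA.
Qed.

End GaussNewton.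

(** * Errors of [fTLS] and [etaTLS] in terms of the error of [x] *)

Lemma ler_dist_fTLS (R : realType) m n (A : 'M[R]_(m, n)) b x y :
  norm2 (fTLS A b x - fTLS A b y) <= 2 * normF (row_mx A b) * norm2 (x - y).
Proof.
(* Both values are images under [C] of normalized augmented vectors; the factor 2 comes from
   [norm2_normalizeB]. *)
rewrite !fTLSE 2!scalemxAr -mulmxBr !muTLSE -(norm2_augB x y) -mulrA mulrCA.
apply: le_trans (ler_norm2_mul _ _) _; rewrite ler_wpM2l ?normF_ge0 //.
by rewrite norm2_normalizeB ?norm2_aug_ge1.
Qed.

(* [aug y] is a critical zero of the form [q z = |C z|^2 - s^2 |z|^2], hence
   [(eta(x)^2 - s^2) |aug x|^2 = q (aug x) = q (aug x - aug y)]. *)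
Lemma ler_dist_sqr_etaTLS (R : realType) m n (A : 'M[R]_(m, n)) b x y (s : R) :
    let C := row_mx A b in
    dot (C *m aug y) (C *m aug y) = s ^+ 2 * dot (aug y) (aug y) ->
    dot (C *m aug x) (C *m aug y) = s ^+ 2 * dot (aug x) (aug y) ->
    s <= etaTLS A b x -> 0 < s ->
  `|etaTLS A b x - s| <= normF C ^+ 2 / s * norm2 (x - y) ^+ 2.
Proof.
move=> C Cyy Cxy s_le s0; set et := etaTLS A b x.
rewrite ger0_norm ?subr_ge0 // mulrAC ler_pdivlMr //.
rewrite -(norm2_augB x y) -exprMn.
have nx1 := norm2_aug_ge1 x; have nx0 := norm2_aug_gt0 x.
have etE := etaTLS_sqrM A b x; rewrite -/et -/C in etE.
have le_d : dot (C *m (aug x - aug y)) (C *m (aug x - aug y)) <=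
    (normF C * norm2 (aug x - aug y)) ^+ 2.
  by rewrite -sqr_norm2 lerXn2r ?ler_norm2_mul // nnegrE ?mulr_ge0 ?norm2_ge0
    ?normF_ge0.
apply: le_trans le_d; set d := aug x - aug y.
have dd := dot_ge0 d; have s2 := sqr_ge0 s.
have eE : dot (C *m d) (C *m d) =
    (et ^+ 2 - s ^+ 2) * dot (aug x) (aug x) + s ^+ 2 * dot d d.
  rewrite mulrBl etE /d mulmxBr !(dotDl, dotDr, dotNl, dotNr) opprK.
  rewrite (dotC (C *m aug y)) (dotC (aug y) (aug x)) Cyy Cxy; ring.
have xx1 : 1 <= dot (aug x) (aug x) by rewrite -sqr_norm2 exprn_ege1.
(* Factor the difference of squares and use [et + s >= s] and [xx1]. *)
rewrite eE; apply: (@le_trans _ _ ((et ^+ 2 - s ^+ 2) * dot (aug x) (aug x))).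
  have -> : (et - s) * s = (et - s) * s * 1 by rewrite mulr1.
  have es : 0 <= et - s by rewrite subr_ge0.
  rewrite ler_pM ?mulr_ge0 ?(ltW s0) // subr_sqr ler_wpM2l // lerDr.
  exact: le_trans (ltW s0) s_le.
by rewrite lerDl mulr_ge0.
Qed.

(** * The three convergence rates *)

Theorem theorem3p2 (R : realType) (m n : nat) (A : 'M[R]_(m, n)) (b : 'cV[R]_m)
    (sigma : nat -> R) (xTLS : 'cV[R]_n) (x : nat -> 'cV[R]_n)
    (n_gt0 : (0 < n)%N) (n_lt_m : (n < m)%N)
    (rank_C : \rank (row_mx A b) = (n + 1)%N)
    (sigmaP : singular_values (row_mx A b) sigma)
    (xTLS_sol : TLS_solution A b xTLS)
    (xTLS_uniq : forall y : 'cV[R]_n, TLS_solution A b y -> y = xTLS)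
    (xP : GN_TLS_sequence A b x) :
  [/\ (fun k : nat => norm2 (fTLS A b (x k) - fTLS A b xTLS)) =O_\oo
        (fun k : nat => (sigma n.+1 / sigma n) ^+ (2 * k)),
      (fun k : nat => `|etaTLS A b (x k) - sigma n.+1|) =O_\oo
        (fun k : nat => (sigma n.+1 / sigma n) ^+ (4 * k))
    & (fun k : nat => norm2 (x k - xTLS)) =O_\oo
        (fun k : nat => (sigma n.+1 / sigma n) ^+ (2 * k))].
Proof.
have le_n1m : (n + 1 <= m)%N by rewrite addn1.
have [V V_orth gram_coord] := svd_gram le_n1m sigmaP.
have [sigma_ge0 sigma_anti _] := sigmaP.
have n_lt : (n < n + 1)%N by rewrite addn1.
pose N := Ordinal n_lt.
have sigma_gt0 (i : 'I_(n + 1)) : 0 < sigma i.+1.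
  by rewrite lt0r (sigma_neq0 V_orth gram_coord rank_C) sigma_ge0 ?ltn_ord.
have sigma_min (i : 'I_(n + 1)) : sigma N.+1 <= sigma i.+1.
  by rewrite sigma_anti // -[N.+1]addn1 // ltn_ord.
(* Coordinates are 0-based and [N] is the last one, so any other [i] satisfies [i.+1 <= n]. *)
have le_sn (i : 'I_(n + 1)) : i != N -> sigma n <= sigma i.+1.
  move=> iN; rewrite sigma_anti ?addn1 // ltn_neqAle -ltnS -(addn1 n) ltn_ord andbT.
  by apply: contra iN => /eqP iN; apply/eqP/val_inj.
have le_sNn : sigma N.+1 <= sigma n by rewrite sigma_anti ?addn1.
have sn_gt0 : 0 < sigma n by apply: lt_le_trans le_sNn.
have xmin : is_argmin (etaTLS A b) xTLS by apply/TLS_solutionP.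
have [gam0 zE] := unique_argmin V_orth gram_coord sigma_gt0 sigma_min xmin
  (fun y ymin => xTLS_uniq y ((TLS_solutionP A b y).2 ymin)).
(* The vector [aug xTLS] is an eigenvector of [C^T C]; this supplies both criticality conditions of
   [ler_dist_sqr_etaTLS]. *)
have Cz z : dot (row_mx A b *m z) (row_mx A b *m aug xTLS) =
    sigma n.+1 ^+ 2 * dot z (aug xTLS).
  by rewrite zE -scalemxAr !dotZr (dot_gram_col gram_coord) mulrCA.
(* The coordinate bound carries over because [V^T] is an isometry and augmented vectors share their
   last entry. *)
have [K K0 xK] : exists2 K, 0 <= K & forall k,
    norm2 (x k - xTLS) <= K * (sigma n.+1 / sigma n) ^+ (2 * k).
  have dot_last y : dot (V^T *m last_delta R n) (V^T *m aug y) = -1.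
    by rewrite (dot_coord V_orth) dot_last_aug.
  have coord_xTLS i : i != N -> (V^T *m aug xTLS) i 0 = 0.
    move=> /negPf iN; rewrite zE -scalemxAr colE mulmxA V_orth mul1mx !mxE.
    by rewrite iN mulr0.
  have [K K0 zK] := inverse_iteration_bound (sigma_gt0 N) sigma_min sn_gt0 le_sn
    le_sNn gam0 (dot_last _) coord_xTLS (fun k => dot_last (x k))
    (GN_invariant V_orth gram_coord sigma_gt0 gam0 xP).
  exists K => // k; have := zK k.
  by rewrite -mulmxBr (norm2_coord V_orth) norm2_augB.
have rho0 k : 0 <= (sigma n.+1 / sigma n) ^+ k.
  by rewrite exprn_ge0 // divr_ge0 ?(ltW (sigma_gt0 N)) ?ltW.
have F0 := normF_ge0 (row_mx A b).
split.
- apply: (@eqO_of_bound _ _ _ (2 * normF (row_mx A b) * K)) => [|k].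
    by rewrite !mulr_ge0.
  rewrite !ger0_norm ?norm2_ge0 //.
  apply: le_trans (ler_dist_fTLS _ _ _ _) _.
  by rewrite -(mulrA (2 * _)) ler_wpM2l ?mulr_ge0.
- pose B := normF (row_mx A b) ^+ 2 / sigma n.+1.
  apply: (@eqO_of_bound _ _ _ (B * K ^+ 2)) => [|k].
    by rewrite mulr_ge0 ?divr_ge0 ?sqr_ge0 ?(ltW (sigma_gt0 N)).
  rewrite normr_id (ger0_norm (rho0 _)).
  have le_eta := etaTLS_ge_sigma V_orth gram_coord sigma_gt0 sigma_min (x k).
  apply: le_trans (ler_dist_sqr_etaTLS (Cz _) (Cz _) le_eta (sigma_gt0 N)) _.
  rewrite -(mulrA B) ler_wpM2l ?divr_ge0 ?sqr_ge0 ?(ltW (sigma_gt0 N)) //.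
  (* The error of [etaTLS] is quadratic in that of [x k], which doubles the exponent. *)
  rewrite (_ : 4 * k = 2 * k * 2)%N; last by rewrite mulnAC.
  by rewrite exprM -exprMn lerXn2r ?nnegrE ?norm2_ge0 ?mulr_ge0.
apply: (eqO_of_bound K0) => k.
by rewrite !ger0_norm ?norm2_ge0.
Qed.
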